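(* Let $T\subset\mathbb{R}^2$ be a polygon with $N$ edges $e_1,\dots,e_N$, let $(x_i,y_i)$ be the midpoint of $e_i$, $|e_i|$ its length, $\bm{n}_i$ the unit outward normal vector on $e_i$, $|T|$ the area of $T$, and $h$ the diameter of $T$. Let $(x_T,y_T)$ be any point of the plane, let $\kappa>0$, and let $\bm{f}=(f^{(1)},f^{(2)})^t$ be a given source on $T$. Define $$M=\begin{bmatrix}1&x_1-x_T&y_1-y_T\\ \vdots&\vdots&\vdots\\ 1&x_N-x_T&y_N-y_T\end{bmatrix}\in\mathbb{R}^{N\times 3},\qquad E=\mathrm{diag}(|e_1|,\dots,|e_N|)\in\mathbb{R}^{N\times N},$$ $$A=E-EM(M^tEM)^{-1}M^tE,\qquad B=\{b_{i,j}\}_{N\times N},\ b_{i,j}=\bm{n}_i\cdot\bm{n}_j\frac{|e_i||e_j|}{|T|},\qquad D=\{d_{i,j}\}_{3\times N}=(M^tEM)^{-1}M^tE,$$ $$Q_1=\Big\{|e_i|\begin{bmatrix}1\\ 0\end{bmatrix}\cdot\bm{n}_i\Big\}_{N\times1},\qquad Q_2=\Big\{|e_i|\begin{bmatrix}0\\ 1\end{bmatrix}\cdot\bm{n}_i\Big\}_{N\times1},$$ and, for $k=1,2$, $F_k=\{f^{(k)}_i\}_{N\times1}$ with $$f^{(k)}_i=\int_T f^{(k)}(x,y)\big(d_{1,i}+d_{2,i}(x-x_T)+d_{3,i}(y-y_T)\big)\,dT .$$ Then the element stiffness matrix and the element load vector on $T$ of the simplified weak Galerkin (SWG) scheme for the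 Stokes equation, in the unknowns $X_{u_b}=(u_{b,1},\dots,u_{b,N})^t$, $X_{v_b}=(v_{b,1},\dots,v_{b,N})^t$ (edge values of the two velocity components) and $P$ (the constant value of the pressure on $T$), are $$\begin{bmatrix}\kappa h^{-1}A+B&0&-Q_1\\ 0&\kappa h^{-1}A+B&-Q_2\\ Q_1^t&Q_2^t&0\end{bmatrix}\begin{bmatrix}X_{u_b}\\ X_{v_b}\\ P\end{bmatrix}\quad\text{and}\quad\begin{bmatrix}F_1\\ F_2\\ 0\end{bmatrix}.$$ That is, for all $u_b,v_b,w_b,z_b\in W(T)$ and all constants $P,\chi\in\mathbb{R}$, $$\kappa S_T(u_b,w_b)+(\nabla_wu_b,\nabla_ww_b)_T-\Big(\nabla_w\cdot\begin{bmatrix}w_b\\ 0\end{bmatrix},P\Big)_T=X_{w_b}^t\big[(\kappa h^{-1}A+B)X_{u_b}-Q_1P\big],$$ $$\kappa S_T(v_b,z_b)+(\nabla_wv_b,\nabla_wz_b)_T-\Big(\nabla_w\cdot\begin{bmatrix}0\\ z_b\end{bmatrix},P\Big)_T=X_{z_b}^t\big[(\kappa h^{-1}A+B)X_{v_b}-Q_2P\big],$$ $$\Big(\nabla_w\cdot\begin{bmatrix}u_b\\ v_b\end{bmatrix},\chi\Big)_T=\big(Q_1^tX_{u_b}+Q_2^tX_{v_b}\big)\chi,$$ $$(f^{(1)},\mathfrak{s}(w_b))_T=X_{w_b}^tF_1,\qquad (f^{(2)},\mathfrak{s}(z_b))_T=X_{z_b}^tF_2 .$$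
   Context: $W(T)$ is the space of functions on $\partial T$ that are constant on each edge of the polygon $T$; for $u_b\in W(T)$ write $u_{b,i}=u_b|_{e_i}$ and $X_{u_b}=(u_{b,1},\dots,u_{b,N})^t$. $P_1(T)$ is the space of polynomials of degree at most $1$ on $T$, $M_i=(x_i,y_i)$ is the midpoint of $e_i$, and $(\cdot,\cdot)_T$ is the $L^2(T)$ inner product. Weak gradient: $\nabla_wu_b=\frac1{|T|}\sum_{i=1}^Nu_{b,i}|e_i|\bm{n}_i$ (a constant vector on $T$). Weak divergence of $\bm{u}_b\in[W(T)]^2$: the constant $\nabla_w\cdot\bm{u}_b=\frac1{|T|}\sum_{i=1}^N\bm{u}_b|_{e_i}\cdot\bm{n}_i|e_i|$. Linear extension: $\mathfrak{s}(u_b)\in P_1(T)$ is the unique linear function with $\sum_{i=1}^N(\mathfrak{s}(u_b)(M_i)-u_{b,i})\,v(M_i)|e_i|=0$ for all $v\in P_1(T)$. Stabilizer: $S_T(u_b,v_b)=h^{-1}\sum_{i=1}^N(\mathfrak{s}(u_b)(M_i)-u_{b,i})(\mathfrak{s}(v_b)(M_i)-v_{b,i})|e_i|$. The SWG scheme for $-\Delta\bm{u}+\nabla p=\bm{f}$, $\mathrm{div}\,\bm{u}=0$ with zero boundary values seeks edge-wise constant velocities $(u_b,v_b)$, vanishing on the domain boundary, and a piecewise constant pressure $p_h$ such that, for all edge-wise constant $w_b,z_b$ vanishing on the domain boundary and piecewise constant $\chi$, $\sum_T[\kappa S_T(u_b,w_b)+(\nabla_wu_b,\nabla_ww_b)_T-(\nabla_w\cdot(w_b,0)^t,p_h)_T]=\sum_T(f^{(1)},\mathfrak{s}(w_b))_T$,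 $\sum_T[\kappa S_T(v_b,z_b)+(\nabla_wv_b,\nabla_wz_b)_T-(\nabla_w\cdot(0,z_b)^t,p_h)_T]=\sum_T(f^{(2)},\mathfrak{s}(z_b))_T$, and $\sum_T(\nabla_w\cdot(u_b,v_b)^t,\chi)_T=0$. The element stiffness matrix and load vector are those of the contributions of a single element $T$ with respect to the edge basis. *)

(* Defs.v *)
From HB Require Import structures.
From mathcomp Require Import all_boot all_order all_algebra.
From mathcomp Require Import all_classical all_reals all_analysis.

Set Implicit Arguments.
Unset Strict Implicit.
Unset Printing Implicit Defensive.

Import Order.TTheory GRing.Theory Num.Theory.
Import numFieldNormedType.Exports.

Local Open Scope classical_set_scope.
Local Open Scope ring_scope.

Section Plane.
Context {R : realType}.
Implicit Types a b : R * R.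

Definition dot a b : R := a.1 * b.1 + a.2 * b.2.

(* The norm [`|a|] of the product type R * R is the max norm, hence this
   Euclidean one. *)
Definition enorm a : R := Num.sqrt (dot a a).

Definition closed_segment a b : set (R * R) :=
  [set a + t *: (b - a) | t in `[0, 1]].
Definition open_segment a b : set (R * R) :=
  [set a + t *: (b - a) | t in `]0, 1[].

Definition lebesgue2 := (@lebesgue_measure R \x @lebesgue_measure R)%E.

Definition area (T : set (R * R)) : R := fine (lebesgue2 T).

Definition diameter (T : set (R * R)) : R :=
  sup [set enorm (ab.1 - ab.2) | ab in T `*` T].

Definition inner (T : set (R * R)) (f g : R * R -> R) : R :=
  \int[lebesgue2]_(x in T) (f x * g x).
Definition vinner (T : set (R * R)) (f g : R * R -> R * R) : R :=
  \int[lebesgue2]_(x in T) dot (f x) (g x).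

Definition P1 : set (R * R -> R) :=
  [set v | exists a b c : R, forall x, v x = a + b * x.1 + c * x.2].

End Plane.

Section Polygon.
Context {R : realType} {N : nat}.
Variable p : 'I_N -> R * R.

(* The vertices are listed cyclically: [ordS] is the successor modulo N. *)
Definition edge (i : 'I_N) := closed_segment (p i) (p (ordS i)).
Definition edge_interior (i : 'I_N) := open_segment (p i) (p (ordS i)).
Definition elen (i : 'I_N) : R := enorm (p (ordS i) - p i).
Definition emid (i : 'I_N) : R * R := 2^-1 *: (p i + p (ordS i)).

(* The closed polygonal line through the vertices is simple: two distinct edges
   have at most common endpoints. Straight angles are allowed. *)
Definition simple_polygon : Prop :=
  [/\ (2 < N)%N, injective p &
      forall i j : 'I_N, i != j ->
        edge i `&` edge j `<=`
        [set p i; p (ordS i)] `&` [set p j; p (ordS j)] ].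

(* T is the closed region enclosed by the polygonal line. By the Jordan curve
   theorem this is the only compact set with nonempty interior whose
   topological boundary is the union of the edges. *)
Definition polygon (T : set (R * R)) : Prop :=
  [/\ simple_polygon, compact T, T° !=set0 &
      closure T `\` T° = \bigcup_(i in [set: 'I_N]) edge i].

Definition unit_outward_normals (T : set (R * R)) (n : 'I_N -> R * R) : Prop :=
  forall i, [/\ enorm (n i) = 1, dot (n i) (p (ordS i) - p i) = 0 &
    forall x, edge_interior i x -> \forall t \near 0^'+, ~ T (x + t *: n i)].

(* Constancy is required on the open edges only, since each vertex lies on two
   edges; values off the boundary of the polygon are irrelevant. *)
Definition W : set (R * R -> R) :=
  [set u | forall i x y, edge_interior i x -> edge_interior i y -> u x = u y].

Definition edge_val {V : Type} (u : R * R -> V) (i : 'I_N) : V := u (emid i).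

Definition Xvec (u : R * R -> R) : 'cV[R]_N := \col_i edge_val u i.

Definition is_linear_extension (u s : R * R -> R) : Prop :=
  P1 s /\ forall v, P1 v ->
    \sum_i (s (emid i) - edge_val u i) * v (emid i) * elen i = 0.

Definition linear_extension (u : R * R -> R) : R * R -> R :=
  get [set s | is_linear_extension u s].

Definition edge_basis (i : 'I_N) : R * R -> R := \1_(edge_interior i).

End Polygon.

Section SWG.
Context {R : realType} {N : nat}.
Variables (p : 'I_N -> R * R) (T : set (R * R)) (n : 'I_N -> R * R).

Definition weak_grad (u : R * R -> R) : R * R :=
  (area T)^-1 *: \sum_i (edge_val p u i * elen p i) *: n i.

Definition weak_div (u : R * R -> R * R) : R :=
  (area T)^-1 * \sum_i dot (edge_val p u i) (n i) * elen p i.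

Definition stabilizer (u v : R * R -> R) : R :=
  (diameter T)^-1 *
  \sum_i (linear_extension p u (emid p i) - edge_val p u i)
       * (linear_extension p v (emid p i) - edge_val p v i) * elen p i.

Definition vel (u v : R * R -> R) : R * R -> R * R := fun x => (u x, v x).

(* Contributions of T to the two momentum equations and to the mass equation. *)
Definition momentum1 (kappa : R) (u : R * R -> R) (P : R) (w : R * R -> R) : R :=
  kappa * stabilizer u w
  + vinner T (cst (weak_grad u)) (cst (weak_grad w))
  - inner T (cst (weak_div (vel w (cst 0)))) (cst P).
Definition momentum2 (kappa : R) (v : R * R -> R) (P : R) (z : R * R -> R) : R :=
  kappa * stabilizer v z
  + vinner T (cst (weak_grad v)) (cst (weak_grad z))
  - inner T (cst (weak_div (vel (cst 0) z))) (cst P).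
Definition mass (u v : R * R -> R) (chi : R) : R :=
  inner T (cst (weak_div (vel u v))) (cst chi).

Definition load1 (f : R * R -> R * R) (w : R * R -> R) : R :=
  inner T (fun x => (f x).1) (linear_extension p w).
Definition load2 (f : R * R -> R * R) (z : R * R -> R) : R :=
  inner T (fun x => (f x).2) (linear_extension p z).

Definition local_space : Type := (R * R -> R) * (R * R -> R) * R.

Definition local_form (kappa : R) (U V : local_space) : R :=
  let: (u, v, P) := U in let: (w, z, chi) := V in
  momentum1 kappa u P w + momentum2 kappa v P z + mass u v chi.

Definition local_load (f : R * R -> R * R) (V : local_space) : R :=
  let: (w, z, _) := V in load1 f w + load2 f z.

(* Ordering of the unknowns: u on the edges, v on the edges, pressure. *)
Definition local_basis (a : 'I_(N + N + 1)) : local_space :=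
  match fintype.split a with
  | inl b => match fintype.split b with
             | inl i => (edge_basis p i, cst 0, 0)
             | inr i => (cst 0, edge_basis p i, 0)
             end
  | inr _ => (cst 0, cst 0, 1)
  end.

(* Rows are indexed by test functions, columns by unknowns. *)
Definition element_stiffness (kappa : R) : 'M[R]_(N + N + 1) :=
  \matrix_(a, b) local_form kappa (local_basis b) (local_basis a).

Definition element_load (f : R * R -> R * R) : 'cV[R]_(N + N + 1) :=
  \col_a local_load f (local_basis a).

End SWG.

Section Matrices.
Context {R : realType} {N : nat}.
Variables (p : 'I_N -> R * R) (T : set (R * R)) (n : 'I_N -> R * R).
Variable c : R * R.

Definition Mmx : 'M[R]_(N, 3) :=
  \matrix_(i, j) [:: 1; (emid p i).1 - c.1; (emid p i).2 - c.2]`_j.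

Definition Emx : 'M[R]_N := diag_mx (\row_i elen p i).

Definition MEM : 'M[R]_3 := Mmx^T *m Emx *m Mmx.

Definition Dmx : 'M[R]_(3, N) := invmx MEM *m Mmx^T *m Emx.

Definition Amx : 'M[R]_N := Emx - Emx *m Mmx *m invmx MEM *m Mmx^T *m Emx.

Definition Bmx : 'M[R]_N :=
  \matrix_(i, j) (dot (n i) (n j) * (elen p i * elen p j / area T)).

Definition Qvec (d : R * R) : 'cV[R]_N := \col_i (elen p i * dot d (n i)).

(* Row indices of [Dmx] start at 0. *)
Definition Fvec (g : R * R -> R) : 'cV[R]_N :=
  \col_i \int[lebesgue2]_(x in T)
    (g x * (Dmx 0 i + Dmx 1 i * (x.1 - c.1) + Dmx 2 i * (x.2 - c.2))).

End Matrices.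

(* Main.v *)
(* In the weighted inner product given by [Emx], the linear extension is the
   orthogonal projection of the vector of edge values onto the range of [Mmx],
   so it has coefficients [Dmx *m Xvec p u] as soon as the normal matrix [MEM]
   is invertible. As edges have positive length, this amounts to the edge
   midpoints of a simple polygon not lying on one line. The remaining terms are
   integrals of constants, for which [0 < area T] is needed because of the
   division by the area, and integrals of the source against affine functions.
 *)
Require Import Defs.
From HB Require Import structures.
From mathcomp Require Import all_boot all_order all_algebra.
From mathcomp Require Import all_classical all_reals all_analysis.
From mathcomp Require Import measurable_realfun.
From mathcomp Require Import ring lra.
Import Order.TTheory GRing.Theory Num.Theory.
Import numFieldNormedType.Exports.
Local Open Scope classical_set_scope.
Local Open Scope ring_scope.

(** * Cyclic successor of an index *)

Lemma ordS_neq (N : nat) (i : 'I_N) : (1 < N)%N -> ordS i != i.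
Proof.
move=> N1; apply/eqP => /(congr1 val) /= ii.
(* Read modulo [N], the equation is [i + 0 = i + 1]; cancelling [i] leaves [0 = 1], false for
   [1 < N]. *)
have := modn_small (ltn_ord i); rewrite -{2}ii -[in RHS]addn1 -{1}(addn0 i).
by move/eqP; rewrite eqn_modDl mod0n modn_small.
Qed.

Lemma ordS2_neq (N : nat) (i : 'I_N) : (2 < N)%N -> ordS (ordS i) != i.
Proof.
move=> N2; apply/eqP => /(congr1 val) /=.
rewrite -addn1 modnDml addn1 -addn2 => ii.
have := modn_small (ltn_ord i); rewrite -{2}ii -{1}(addn0 i).
by move/eqP; rewrite eqn_modDl mod0n modn_small.
Qed.

(** Exposes the products hidden in the components of a scaled point to [ring], [field] and [lra]. *)
Lemma realscaleE (R : realType) (a b : R) : a *: b = a * b.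
Proof. by []. Qed.

(** * Edges and midpoints of a simple polygon *)

Section SimplePolygon.
Context {R : realType} {N : nat}.
Variable p : 'I_N -> R * R.
Hypothesis simple_p : simple_polygon p.

Lemma vertex_neq_next i : p (ordS i) != p i.
Proof.
have [N2 p_inj _] := simple_p.
by rewrite (inj_eq p_inj) ordS_neq// (ltn_trans _ N2).
Qed.

Lemma elen_gt0 i : 0 < elen p i.
Proof.
have : p (ordS i) - p i != 0 by rewrite subr_eq0 vertex_neq_next.
rewrite /elen /enorm sqrtr_gt0 /dot; move: (_ - _) => [x y].
rewrite -pair_eqE negb_and /= -!expr2 => /orP[x0|y0].
- by rewrite ltr_wpDr ?sqr_ge0// exprn_even_gt0.
- by rewrite ltr_wpDl ?sqr_ge0// exprn_even_gt0.
Qed.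

Lemma emidE i : emid p i = p i + 2^-1 *: (p (ordS i) - p i).
Proof.
rewrite /emid; case: (p i) (p (ordS i)) => [a b] [u v].
by congr pair; rewrite /= !realscaleE; field.
Qed.

Lemma emid_edge_interior i : edge_interior p i (emid p i).
Proof.
exists 2^-1; last by rewrite emidE.
by rewrite /= in_itv /=; apply/andP; split; lra.
Qed.

Lemma edge_interior_sub i : edge_interior p i `<=` edge p i.
Proof.
by move=> _ [t /= /itvP tI <-]; exists t => //=; rewrite in_itv /= !tI.
Qed.

Lemma edge_interior_neq i x :
  edge_interior p i x -> x != p i /\ x != p (ordS i).
Proof.
have /negbTE ii := vertex_neq_next i.
move=> [t /= /itvP tI <-]; split.
  by rewrite -subr_eq0 addrC addKr scaler_eq0 subr_eq0 ii orbF gt_eqF ?tI.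
rewrite (_ : _ + _ = p (ordS i) + (t - 1) *: (p (ordS i) - p i)).
  rewrite -subr_eq0 addrC addKr scaler_eq0 !subr_eq0 ii orbF.
  by rewrite lt_eqF ?tI.
by rewrite scalerBl scale1r opprB [RHS]addrC addrA addrNK addrC.
Qed.

(** A point shared by two edges is an endpoint of both, and an open edge contains neither of its
    endpoints. *)
Lemma edge_interior_disjoint i j x :
  i != j -> edge_interior p i x -> ~ edge p j x.
Proof.
have [_ _ dis] := simple_p.
move=> ij xi xj; have [/eqP n1 /eqP n2] := edge_interior_neq i x xi.
by have [[]] := dis _ _ ij x (conj (edge_interior_sub _ _ xi) xj).
Qed.

(* An affine [l] vanishing at all midpoints takes opposite values at the ends of
   each edge. The edges before and after the one with the leftmost midpoint on
   the line [l = 0] would then cross. *)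
Lemma midpoints_not_collinear (a b c : R) :
  (forall i, a + b * (emid p i).1 + c * (emid p i).2 = 0) ->
  [/\ a = 0, b = 0 & c = 0].
Proof.
have [N2 p_inj _] := simple_p => l0.
pose l (x : R * R) := a + b * x.1 + c * x.2.
(* [g] is the coordinate along the line [l = 0]: [l] and [g] together are affine coordinates of the
   plane once [b ^+ 2 + c ^+ 2] is nonzero. *)
pose g (x : R * R) := b * x.2 - c * x.1.
have i0 : 'I_N := Ordinal (ltn_trans (ltn0Sn 1) N2).
suff /eqP : b ^+ 2 + c ^+ 2 = 0.
  rewrite paddr_eq0 ?sqr_ge0// !sqrf_eq0 => /andP[/eqP b0 /eqP c0].
  by split => //; move: (l0 i0); rewrite b0 c0 !mul0r !addr0.
apply/eqP/negPn/negP => bc0.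
have lg_inj x y : l x = l y -> g x = g y -> x = y.
  case: x y => [x1 x2] [y1 y2]; rewrite /l /g /= => lxy gxy.
  have {}lxy : b * (x1 - y1) + c * (x2 - y2) = 0 by lra.
  have {}gxy : b * (x2 - y2) - c * (x1 - y1) = 0 by lra.
  congr pair; apply/eqP; rewrite -subr_eq0 -(mulrI_eq0 _ (mulfI bc0));
    apply/eqP.
  - transitivity (b * (b * (x1 - y1) + c * (x2 - y2)) -
      c * (b * (x2 - y2) - c * (x1 - y1))); first by ring.
    by rewrite lxy gxy !mulr0 subr0.
  - transitivity (c * (b * (x1 - y1) + c * (x2 - y2)) +
      b * (b * (x2 - y2) - c * (x1 - y1))); first by ring.
    by rewrite lxy gxy !mulr0 addr0.
have lS i : l (p (ordS i)) = - l (p i).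
  by have := l0 i; rewrite /emid /l /= !realscaleE; lra.
(* [G i] is twice the value of [g] at the midpoint of edge [i]. *)
pose G i := g (p i) + g (p (ordS i)).
have [i _ imin] := @arg_minP _ _ _ i0 predT G isT.
pose j := ord_pred i; pose k := ordS i; pose m := ordS k.
have jS : ordS j = i by exact: ord_predK.
have jk : j != k by rewrite -(inj_eq (@ordS_inj N)) jS eq_sym ordS2_neq.
have im : i != m by rewrite eq_sym ordS2_neq.
have lj : l (p j) = - l (p i) by rewrite -jS lS opprK.
have lk : l (p k) = - l (p i) by rewrite lS.
have lm : l (p m) = l (p i) by rewrite lS lk opprK.
(* Minimality of [G i] against a neighbouring edge cancels the shared vertex. The two vertices left
   have the same [l], so being distinct they differ in [g]. *)
have gjk : g (p k) < g (p j).
  rewrite lt_neqAle; apply/andP; split.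
    apply: contra jk => /eqP gjk; apply/eqP/p_inj.
    by apply: lg_inj => //; rewrite lj lk.
  by have := imin j isT; rewrite /G jS /k; lra.
have gim : g (p i) < g (p m).
  rewrite lt_neqAle; apply/andP; split.
    by apply: contra im => /eqP gim; apply/eqP/p_inj; exact: lg_inj.
  by have := imin k isT; rewrite /G /m /k; lra.
(* Edges [j] and [k] both run from level [- l (p i)] to level [l (p i)], so points of equal
   parameter agree in [l]. Their difference in [g] falls linearly from a positive to a negative
   value; [d] is the total drop and [t] the zero. *)
pose d := g (p j) - g (p k) + (g (p m) - g (p i)).
have d0 : 0 < d by rewrite /d; lra.
pose t := (g (p j) - g (p k)) / d.
have t0 : 0 < t by rewrite divr_gt0 ?subr_gt0.
have t1 : t < 1 by rewrite ltr_pdivrMr// mul1r /d; lra.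
have td : t * d = g (p j) - g (p k) by rewrite mulfVK// gt_eqF.
have tI : t \in `]0, 1[ by rewrite in_itv /= t0.
have xE : p j + t *: (p i - p j) = p k + t *: (p m - p k).
  have lD x y : l (x + t *: (y - x)) = l x + t * (l y - l x).
    by rewrite /l /= !realscaleE; ring.
  have gD x y : g (x + t *: (y - x)) = g x + t * (g y - g x).
    by rewrite /g /= !realscaleE; ring.
  apply: lg_inj; first by rewrite !lD lj lk lm.
  by rewrite !gD; move: td; rewrite /d; lra.
apply: (edge_interior_disjoint j k (p j + t *: (p i - p j)) jk).
  by exists t => //; rewrite jS.
by rewrite xE; apply: edge_interior_sub; exists t.
Qed.

(** The midpoint sampled by [edge_val] is interior to edge [j], hence on no other edge. *)
Lemma edge_val_basis i j : edge_val p (edge_basis p i) j = (i == j)%:R.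
Proof.
rewrite /edge_val /edge_basis indicE; congr (_%:R); congr nat_of_bool.
have [<-|ij] := eqVneq i j.
  by rewrite mem_set//; exact: emid_edge_interior.
apply/negbTE/negP => /set_mem /edge_interior_disjoint -/(_ _ ij); apply.
exact/edge_interior_sub/emid_edge_interior.
Qed.

End SimplePolygon.

(** * The linear extension as a weighted least-squares fit *)

Section LinearExtension.
Context {R : realType} {N : nat}.
Variables (p : 'I_N -> R * R) (c : R * R).
Hypothesis simple_p : simple_polygon p.

Local Notation M := (Mmx p c).
Local Notation E := (Emx p).
Local Notation G := (MEM p c).
Local Notation D := (Dmx p c).

(** The basis is centred at [c] to match the columns of [Mmx]. *)
Definition affine (a : 'cV[R]_3) (x : R * R) : R :=
  a 0 0 + a 1 0 * (x.1 - c.1) + a 2 0 * (x.2 - c.2).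

Lemma affine_emid a i : affine a (emid p i) = (M *m a) i 0.
Proof.
rewrite /affine mxE !big_ord_recl big_ord0 !mxE /= mul1r addr0 addrA.
congr (_ + _ + _); rewrite mulrC; congr (_ * a _ _); exact/val_inj.
Qed.

Lemma affineP v : P1 v <-> exists a, v = affine a.
Proof.
split=> [[a0 [a1 [a2 vE]]]|[a ->]].
  exists (\col_i [:: a0 + a1 * c.1 + a2 * c.2; a1; a2]`_i).
  by apply/funext => x; rewrite vE /affine !mxE /=; ring.
exists (a 0 0 - a 1 0 * c.1 - a 2 0 * c.2), (a 1 0), (a 2 0) => x.
by rewrite /affine; ring.
Qed.

Lemma weighted_dotE (x y : 'cV[R]_N) :
  (x^T *m E *m y) 0 0 = \sum_i x i 0 * y i 0 * elen p i.
Proof.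
rewrite -mulmxA mxE; apply: eq_bigr => i _.
by rewrite mul_diag_mx !mxE; ring.
Qed.

(** A null vector of [G] gives [M *m a] zero weighted norm. The weights are positive, so its affine
    function vanishes at all midpoints, which are not collinear. *)
Lemma MEM_unitmx : G \in unitmx.
Proof.
rewrite -row_free_unit; apply: inj_row_free => v vG0.
pose a := v^T.
have aG : (M *m a)^T *m E *m (M *m a) = 0.
  by rewrite trmx_mul trmxK !mulmxA -(mulmxA v) -(mulmxA v) vG0 mul0mx.
have Ma0 i : (M *m a) i 0 = 0.
  have := congr1 (fun B : 'M[R]_1 => B 0 0) aG.
  rewrite weighted_dotE mxE => /eqP; rewrite psumr_eq0; last first.
    by move=> j _; rewrite -expr2 mulr_ge0 ?sqr_ge0 ?(ltW (elen_gt0 _ _ _)).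
  move=> /allP /(_ i (mem_index_enum _)) /=.
  by rewrite !mulf_eq0 orbb (gt_eqF (elen_gt0 _ simple_p _))// orbF => /eqP.
(* The coefficients are converted from the basis centred at [c] to the monomials 1, x, y. *)
have [|a0 a1 a2] := midpoints_not_collinear p simple_p
    (a 0 0 - a 1 0 * c.1 - a 2 0 * c.2) (a 1 0) (a 2 0).
  by move=> i; rewrite -[RHS](Ma0 i) -affine_emid /affine; ring.
apply/trmx_inj; rewrite trmx0 -/a; apply/matrixP => i j; rewrite ord1 [RHS]mxE.
move: a0; rewrite a1 a2 !mul0r !subr0 => a0.
case: i => -[|[|[|//]]] i3.
- by rewrite -[RHS]a0; congr (a _ _); exact/val_inj.
- by rewrite -[RHS]a1; congr (a _ _); exact/val_inj.
- by rewrite -[RHS]a2; congr (a _ _); exact/val_inj.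
Qed.

(** Orthogonality of the residual to all affine functions is the system of normal equations,
    uniquely solvable because [G] is invertible. The equivalence carries both existence and
    uniqueness. *)
Lemma is_linear_extensionP u s :
  is_linear_extension p u s <-> s = affine (D *m Xvec p u).
Proof.
have sumE a b : \sum_i (affine a (emid p i) - edge_val p u i) *
    affine b (emid p i) * elen p i =
    (b^T *m (M^T *m E *m (M *m a - Xvec p u))) 0 0.
  rewrite !mulmxA -trmx_mul weighted_dotE; apply: eq_bigr => i _.
  have -> : (M *m a - Xvec p u) i 0 = affine a (emid p i) - edge_val p u i.
    by rewrite affine_emid [LHS]mxE; congr (_ + _); rewrite !mxE.
  by rewrite !affine_emid; ring.
have normal_eq a :
    (M^T *m E *m (M *m a - Xvec p u) == 0) = (a == D *m Xvec p u).
  rewrite mulmxBr mulmxA -/(MEM p c) subr_eq0 /Dmx -!(mulmxA (invmx G)).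
  by apply: (can2_eq (mulKmx MEM_unitmx) (mulKVmx MEM_unitmx)).
split=> [[/affineP[a ->] ortho]|->].
  congr affine; apply/eqP; rewrite -normal_eq; apply/eqP/matrixP => i j.
  rewrite ord1 [RHS]mxE.
  (* Testing with the [i]-th basis function reads off the [i]-th normal equation. *)
  have := ortho (affine (delta_mx i 0)).
  rewrite sumE trmx_delta -rowE mxE; apply.
  by apply/affineP; exists (delta_mx i 0).
split; first by apply/affineP; exists (D *m Xvec p u).
move=> v /affineP[b ->]; rewrite sumE.
have /eqP -> : M^T *m E *m (M *m (D *m Xvec p u) - Xvec p u) == 0.
  by rewrite normal_eq.
by rewrite mulmx0 mxE.
Qed.

Lemma linear_extensionE u :
  linear_extension p u = affine (D *m Xvec p u).
Proof.
apply/is_linear_extensionP; rewrite /linear_extension.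
by apply: getPex; exists (affine (D *m Xvec p u)); exact/is_linear_extensionP.
Qed.

(* [A] is the Gram matrix of the residual map [M D - 1] for the inner product
   weighted by [E], since the range of [M D - 1] is [E]-orthogonal to that of
   [M]. *)
Lemma AmxE : Amx p c = (M *m D - 1%:M)^T *m E *m (M *m D - 1%:M).
Proof.
have MEres0 : M^T *m E *m (M *m D - 1%:M) = 0.
  rewrite mulmxBr mulmxA -/(MEM p c) /Dmx -!(mulmxA (invmx G)).
  by rewrite mulKVmx ?MEM_unitmx// mulmx1 subrr.
rewrite [(_ - _)^T]linearB /= trmx1 trmx_mul mulmxBl mul1mx mulmxBl.
rewrite -!mulmxA (mulmxA M^T) MEres0 mulmx0 sub0r mulmxBr mulmx1 opprB.
by rewrite /Amx /Dmx !mulmxA.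
Qed.

Lemma stabilizerE T u w : stabilizer p T u w =
  (diameter T)^-1 * ((Xvec p w)^T *m Amx p c *m Xvec p u) 0 0.
Proof.
have residual v i : linear_extension p v (emid p i) - edge_val p v i =
    ((M *m D - 1%:M) *m Xvec p v) i 0.
  rewrite linear_extensionE affine_emid mulmxBl mul1mx mulmxA.
  by rewrite [RHS]mxE; congr (_ + _); rewrite !mxE.
rewrite /stabilizer AmxE; move: (M *m D - 1%:M) residual => F residual.
rewrite !mulmxA -trmx_mul -(mulmxA _ F) weighted_dotE.
by congr (_ * _); apply: eq_bigr => i _; rewrite !residual; ring.
Qed.

End LinearExtension.

(** * Lebesgue measure and integration on compact plane sets *)

Section PlaneMeasure.
Context {R : realType}.

(** The product sigma-algebra is generated by rectangles, so [U] is written as a countable union of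
    squares with rational centres and radii [1 / (k + 1)]. *)
Lemma open_plane_measurable (U : set (R * R)) :
  open U -> measurable (U : set (measurableTypeR R * measurableTypeR R)).
Proof.
move=> oU.
pose box (q : rat * rat) (k : nat) : set (R * R) :=
  ball (ratr q.1 : R) k.+1%:R^-1 `*` ball (ratr q.2 : R) k.+1%:R^-1.
have -> : U = \bigcup_a \bigcup_b \bigcup_k
    (* Squares not inside [U] are replaced by the empty set, so the indices range over full
       countable types. *)
    (if `[< box (a, b) k `<=` U >] then box (a, b) k else set0).
  apply/seteqP; split=> [[x y] Uxy|z [a _ [b _ [k _]]]]; last first.
    by case: asboolP => // + ?; apply.
  have /nbhs_ballP[e /= e0 xyU] : nbhs (x, y) U.
    exact: open_nbhs_nbhs.
  (* In each coordinate, two points of a square are closer than twice its radius, hence the bound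
     [e / 2]. *)
  have [k ke] : exists k : nat, k.+1%:R^-1 < e / 2.
    exists (Num.truncn (e / 2)^-1); rewrite invf_plt ?posrE ?divr_gt0 ?ltr0n//.
    by rewrite truncnS_gt.
  have ratball z : exists q : rat, ball (ratr q : R) k.+1%:R^-1 z.
    have [w [zw [q _ qE]]] : ball z k.+1%:R^-1 `&` range (@ratr R) !=set0.
      apply: dense_rat; last by apply: ball_open; rewrite invr_gt0 ltr0n.
      by exists z; apply: ballxx; rewrite invr_gt0 ltr0n.
    by exists q; rewrite qE; exact: ball_sym.
  have [[a xa] [b yb]] := (ratball x, ratball y).
  exists a => //; exists b => //; exists k => //.
  rewrite asboolT; first by split.
  move=> [s t] [/= sa tb]; apply: xyU.
  have e2 : k.+1%:R^-1 + k.+1%:R^-1 <= e by rewrite [leRHS]splitr lerD// ltW.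
  split; apply: (le_ball e2).
  - exact: ball_triangle (ball_sym xa) sa.
  - exact: ball_triangle (ball_sym yb) tb.
apply: bigcupT_measurable_rat => a; apply: bigcupT_measurable_rat => b.
apply: bigcupT_measurable => k; case: asboolP => // _.
by apply: measurableX; exact: measurable_ball.
Qed.

Lemma lebesgue2X (A B : set (measurableTypeR R)) :
  measurable A -> measurable B ->
  lebesgue2 (A `*` B) = (lebesgue_measure A * lebesgue_measure B)%E.
Proof. exact: product_measure1E. Qed.

Variable T : set (R * R).
Hypothesis cT : compact T.

Lemma compact_plane_measurable :
  measurable (T : set (measurableTypeR R * measurableTypeR R)).
Proof.
rewrite -[T]setCK; apply: measurableC; apply: open_plane_measurable.
apply: closed_openC; apply: compact_closed cT.
exact: (@norm_hausdorff R (R * R)%type).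
Qed.

Lemma compact_plane_box : exists r : R, T `<=` `[- r, r] `*` `[- r, r].
Proof.
have [M [_ TM]] := compact_bounded cT.
(* Boundedness holds for every bound strictly above [M]. *)
exists (M + 1) => -[x y] Txy.
have : `|(x, y)| <= M + 1 by apply: TM => //; rewrite ltrDl.
by rewrite prod_normE /= ge_max !ler_norml => /andP[xM yM]; split;
  rewrite /= in_itv.
Qed.

Lemma compact_plane_lty : (lebesgue2 T < +oo)%E.
Proof.
have [r Tr] := compact_plane_box.
apply: (@le_lt_trans _ _ (lebesgue2 (`[- r, r] `*` `[- r, r]))).
  apply: le_measure => //; rewrite inE; first exact: compact_plane_measurable.
  exact: measurableX.
rewrite lebesgue2X// lebesgue_measure_itv /=.
by case: ifP => _; rewrite ?mul0e// -EFinB -EFinM ltry.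
Qed.

(** An interior point has a max-norm ball in [T], a square of positive measure. Finiteness matters
    too, since [fine] sends infinity to 0. *)
Lemma area_gt0 : T° !=set0 -> 0 < area T.
Proof.
move=> [x]; rewrite /interior => /nbhs_ballP[e /= e0 xT].
apply: fine_gt0; rewrite compact_plane_lty andbT.
apply: (@lt_le_trans _ _ (lebesgue2 (ball x.1 e `*` ball x.2 e))); last first.
  apply: le_measure => //; rewrite inE; last exact: compact_plane_measurable.
  by apply: measurableX; exact: measurable_ball.
rewrite lebesgue2X; [|exact: measurable_ball..].
by rewrite !lebesgue_measure_ball ?ltW// -EFinM lte_fin mulr_gt0// mulrn_wgt0.
Qed.

Lemma area_integral_cst r : \int[lebesgue2]_(x in T) r = r * area T.
Proof. exact: (Rintegral_cst _ compact_plane_measurable). Qed.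

(** The affine factor is measurable and bounded on a box containing [T]. *)
Lemma integrable_mul_affine (g : R * R -> R) (a b c x0 y0 : R) :
  lebesgue2.-integrable T (fun x => (g x)%:E) ->
  lebesgue2.-integrable T
    (fun x => (g x * (a + b * (x.1 - x0) + c * (x.2 - y0)))%:E).
Proof.
move=> gT; pose l (x : R * R) := a + b * (x.1 - x0) + c * (x.2 - y0).
apply: (@integrableMl _ _ _ lebesgue2 _ compact_plane_measurable (EFin \o g) l
  gT).
  apply: measurable_funTS.
  by do ?apply: measurable_funD => //; apply: measurable_funM => //;
    apply: measurable_funB.
have [r Tr] := compact_plane_box.
exists (`|a| + `|b| * (`|r| + `|x0|) + `|c| * (`|r| + `|y0|)).
split; first exact: num_real.
move=> M rM x Tx; apply: le_trans (ltW rM).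
have [] := Tr _ Tx; rewrite /= !in_itv /= -!ler_norml => x1r x2r.
have rr := ler_norm r.
apply: (le_trans (ler_normD _ _)); apply: lerD.
  apply: (le_trans (ler_normD _ _)); apply: lerD => //.
  rewrite normrM ler_wpM2l//; apply: (le_trans (ler_normB _ _)).
  by rewrite lerD2r (le_trans x1r).
rewrite normrM ler_wpM2l//; apply: (le_trans (ler_normB _ _)).
by rewrite lerD2r (le_trans x2r).
Qed.

End PlaneMeasure.

(** The witnesses are the moments of [g] against 1, x - x0 and y - y0. They are fixed before the
    coefficients, so a load and all entries of [Fvec] share them. *)
Lemma integral_mul_affine {R : realType} (T : set (R * R)) (g : R * R -> R)
    (x0 y0 : R) :
  compact T -> lebesgue2.-integrable T (fun x => (g x)%:E) ->
  exists m0 m1 m2 : R, forall a b c,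
    \int[lebesgue2]_(x in T) (g x * (a + b * (x.1 - x0) + c * (x.2 - y0))) =
    a * m0 + b * m1 + c * m2.
Proof.
move=> cT gT; have mT := compact_plane_measurable T cT.
have gI a b c := integrable_mul_affine T cT g a b c x0 y0 gT.
pose m a b c : R :=
  \int[lebesgue2]_(x in T) (g x * (a + b * (x.1 - x0) + c * (x.2 - y0))).
exists (m 1 0 0), (m 0 1 0), (m 0 0 1) => a b c.
have gZ r a' b' c' : lebesgue2.-integrable T (EFin \o
    (fun x => r * (g x * (a' + b' * (x.1 - x0) + c' * (x.2 - y0))))).
  apply: eq_integrable (gI (r * a') (r * b') (r * c')) => // x _.
  by rewrite /=; congr EFin; ring.
have mZ r a' b' c' : r * m a' b' c' = \int[lebesgue2]_(x in T)
    (r * (g x * (a' + b' * (x.1 - x0) + c' * (x.2 - y0)))).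
  by rewrite (RintegralZl _ mT (gI _ _ _)).
rewrite !mZ -(RintegralD mT (gZ _ _ _ _) (gZ _ _ _ _)).
rewrite -(RintegralD mT (integrableD mT (gZ _ _ _ _) (gZ _ _ _ _))).
  by apply: eq_Rintegral => x _; ring.
exact: gZ.
Qed.

(** * Matrix form of the element equations *)

Section ElementMatrices.
Context {R : realType} {N : nat}.
Variables (p : 'I_N -> R * R) (T : set (R * R)) (n : 'I_N -> R * R) (c : R * R).
Hypothesis polygon_T : polygon p T.

Let simple_p : simple_polygon p. Proof. by have [] := polygon_T. Qed.
Let compact_T : compact T. Proof. by have [] := polygon_T. Qed.

Let area_neq0 : area T != 0.
Proof. by rewrite gt_eqF// area_gt0//; have [] := polygon_T. Qed.

Lemma fst_sum (F : 'I_N -> R * R) : (\sum_i F i).1 = \sum_i (F i).1.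
Proof. exact: (big_morph fst). Qed.

Lemma snd_sum (F : 'I_N -> R * R) : (\sum_i F i).2 = \sum_i (F i).2.
Proof. exact: (big_morph snd). Qed.

(** The two gradients bring [1 / area T] squared and the integral of a constant brings [area T],
    which leaves the single division in [Bmx]. *)
Lemma weak_grad_innerE u w :
  vinner T (cst (weak_grad p T n u)) (cst (weak_grad p T n w)) =
  ((Xvec p w)^T *m Bmx p T n *m Xvec p u) 0 0.
Proof.
rewrite /vinner /= (area_integral_cst T compact_T) /weak_grad /dot /=.
rewrite !realscaleE !fst_sum !snd_sum mxE.
pose a := area T.
transitivity (\sum_i \sum_j a^-1 * (edge_val p u i * elen p i) *
    (edge_val p w j * elen p j) * dot (n i) (n j)).
  transitivity (a^-1 * ((\sum_i (edge_val p u i * elen p i) * (n i).1) *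
    (\sum_i (edge_val p w i * elen p i) * (n i).1) +
    (\sum_i (edge_val p u i * elen p i) * (n i).2) *
    (\sum_i (edge_val p w i * elen p i) * (n i).2))).
    by rewrite -/a; field.
  rewrite !mulr_suml -big_split /= mulr_sumr; apply: eq_bigr => i _.
  rewrite !mulr_sumr -big_split /= mulr_sumr; apply: eq_bigr => j _.
  by rewrite /dot; ring.
apply: eq_bigr => i _; rewrite mxE mulr_suml; apply: eq_bigr => j _.
by rewrite !mxE -/a /dot; ring.
Qed.

(** Integration cancels the division by the area. With both components general, it serves the mass
    equation and, with one component zero, each momentum equation. *)
Lemma weak_div_innerE u v P :
  inner T (cst (weak_div p T n (vel u v))) (cst P) =
  ((Qvec p n (1, 0))^T *m Xvec p u + (Qvec p n (0, 1))^T *m Xvec p v) 0 0 * P.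
Proof.
rewrite /inner /= (area_integral_cst T compact_T) /weak_div.
rewrite mulrAC [_ * area T]mulrAC.
rewrite mulVf// mul1r; congr (_ * _); rewrite 3!mxE -big_split /=.
by apply: eq_bigr => i _; rewrite !mxE /dot /edge_val /vel /=; ring.
Qed.

Lemma Xvec0 : Xvec p (cst 0) = 0.
Proof. by apply/matrixP => i j; rewrite !mxE. Qed.

Lemma Xvec_basis i : Xvec p (edge_basis p i) = delta_mx i 0.
Proof.
by apply/matrixP => j k; rewrite !mxE edge_val_basis// ord1 eqxx andbT eq_sym.
Qed.

(** A general [Q] covers both momentum equations at once. *)
Lemma momentumE kappa u w (Q : 'cV[R]_N) P :
  kappa * stabilizer p T u w +
    vinner T (cst (weak_grad p T n u)) (cst (weak_grad p T n w)) -
    (Q^T *m Xvec p w) 0 0 * P =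
  ((Xvec p w)^T *m
    (((kappa * (diameter T)^-1) *: Amx p c + Bmx p T n) *m Xvec p u -
      P *: Q)) 0 0.
Proof.
rewrite (stabilizerE p c)// weak_grad_innerE.
move: (Amx p c) (Bmx p T n) (Xvec p u) (Xvec p w) => A B X Y.
rewrite mulmxBr mulmxA mulmxDr mulmxDl -!scalemxAr -scalemxAl.
(* A 1 by 1 matrix equals its transpose; this puts the test vector on the left. *)
have -> : (Q^T *m Y) 0 0 = (Y^T *m Q) 0 0.
  by rewrite -[in RHS](trmxK Q) -trmx_mul [RHS]mxE.
move: (Y^T *m A *m X) (Y^T *m B *m X) (Y^T *m Q) => a b q.
by rewrite !mxE; ring.
Qed.

Lemma momentum1E kappa u P w :
  momentum1 p T n kappa u P w =
  ((Xvec p w)^T *m (((kappa * (diameter T)^-1) *: Amx p c + Bmx p T n) *m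
    Xvec p u - P *: Qvec p n (1, 0))) 0 0.
Proof. by rewrite /momentum1 weak_div_innerE Xvec0 mulmx0 addr0 momentumE. Qed.

Lemma momentum2E kappa v P z :
  momentum2 p T n kappa v P z =
  ((Xvec p z)^T *m (((kappa * (diameter T)^-1) *: Amx p c + Bmx p T n) *m
    Xvec p v - P *: Qvec p n (0, 1))) 0 0.
Proof. by rewrite /momentum2 weak_div_innerE Xvec0 mulmx0 add0r momentumE. Qed.

(** The extension has coefficients [Dmx *m Xvec p w], so linearity in the coefficients reduces the
    claim to a finite sum over the columns of [Dmx]. *)
Lemma loadE g w :
  lebesgue2.-integrable T (fun x => (g x)%:E) ->
  inner T g (linear_extension p w) = ((Xvec p w)^T *m Fvec p T c g) 0 0.
Proof.
move=> gT.
have [m0 [m1 [m2 mE]]] := integral_mul_affine T g c.1 c.2 compact_T gT.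
rewrite (linear_extensionE p c)// /inner /affine mE !mxE !mulr_suml.
rewrite -!big_split /=.
by apply: eq_bigr => i _; rewrite !mxE mE; ring.
Qed.

(** Edge basis functions have unit vectors as [Xvec], and at most one of the three equations
    contributes to each of the nine blocks. The pressure columns come from the momentum equations,
    hence their sign; the pressure row comes from the mass equation. *)
Lemma element_stiffnessE kappa :
  element_stiffness p T n kappa =
  let K := (kappa * (diameter T)^-1) *: Amx p c + Bmx p T n in
  let Q1 := Qvec p n (1, 0) in
  let Q2 := Qvec p n (0, 1) in
  block_mx (block_mx K 0 0 K) (col_mx (- Q1) (- Q2)) (row_mx Q1^T Q2^T) 0.
Proof.
apply/matrixP => a b; rewrite mxE /= /local_basis.
have rowcol (A : 'M[R]_N) i j :
    ((delta_mx i 0 : 'cV_N)^T *m (A *m (delta_mx j 0 : 'cV_N))) 0 0 = A i j.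
  by rewrite trmx_delta -rowE -colE !mxE.
have entry (Q : 'cV[R]_N) i : ((delta_mx i 0 : 'cV_N)^T *m Q) 0 0 = Q i 0.
  by rewrite trmx_delta -rowE !mxE.
have entryT (Q : 'cV[R]_N) i : (Q^T *m (delta_mx i 0 : 'cV_N)) 0 0 = Q i 0.
  by rewrite -colE !mxE.
case: (split_ordP a) => [a' ->|a' ->]; [case: (split_ordP a') => i ->|];
  (case: (split_ordP b) => [b' ->|b' ->]; [case: (split_ordP b') => j ->|]);
  rewrite ?(block_mxEul, block_mxEur, block_mxEdl, block_mxEdr, col_mxEu,
    col_mxEd, row_mxEl, row_mxEr) ?(unsplitK (inl _)) ?(unsplitK (inr _));
  by rewrite /local_form momentum1E momentum2E /mass weak_div_innerE ?Xvec0
    ?Xvec_basis ?trmx0 ?mulmx0 ?mul0mx ?scale0r ?scale1r ?subr0 ?sub0r ?addr0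
    ?add0r ?rowcol ?entry ?entryT ?mxE ?mul0r ?mulr0 ?mulr1 ?addr0 ?add0r.
Qed.

Lemma element_loadE f :
  lebesgue2.-integrable T (fun x => ((f x).1)%:E) ->
  lebesgue2.-integrable T (fun x => ((f x).2)%:E) ->
  element_load p T f =
  col_mx (col_mx (Fvec p T c (fun x => (f x).1))
                 (Fvec p T c (fun x => (f x).2))) 0.
Proof.
move=> f1 f2; apply/matrixP => a b; rewrite ord1 mxE /local_load /local_basis.
have entry (Q : 'cV[R]_N) i : ((delta_mx i 0 : 'cV_N)^T *m Q) 0 0 = Q i 0.
  by rewrite trmx_delta -rowE !mxE.
case: (split_ordP a) => [a' ->|a' ->]; [case: (split_ordP a') => i ->|];
  rewrite ?(col_mxEu, col_mxEd) ?(unsplitK (inl _)) ?(unsplitK (inr _));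
  by rewrite /load1 /load2 !loadE// ?Xvec0 ?Xvec_basis ?trmx0 ?mul0mx ?entry
    !mxE ?addr0 ?add0r.
Qed.

End ElementMatrices.

Theorem theorem3p1 (R : realType) (N : nat) (p : 'I_N -> R * R)
    (T : set (R * R)) (n : 'I_N -> R * R) (c : R * R) (kappa : R)
    (f : R * R -> R * R) :
  polygon p T ->
  unit_outward_normals p T n ->
  0 < kappa ->
  lebesgue2.-integrable T (fun x => ((f x).1)%:E) ->
  lebesgue2.-integrable T (fun x => ((f x).2)%:E) ->
  let K := (kappa * (diameter T)^-1) *: Amx p c + Bmx p T n in
  let Q1 := Qvec p n (1, 0) in
  let Q2 := Qvec p n (0, 1) in
  let F1 := Fvec p T c (fun x => (f x).1) in
  let F2 := Fvec p T c (fun x => (f x).2) in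
  [/\ MEM p c \in unitmx,
      forall u, W p u -> exists! s, is_linear_extension p u s,
      element_stiffness p T n kappa =
        block_mx (block_mx K 0 0 K) (col_mx (- Q1) (- Q2))
                 (row_mx Q1^T Q2^T) 0,
      element_load p T f = col_mx (col_mx F1 F2) 0 &
      forall (ub vb wb zb : R * R -> R) (P chi : R),
        W p ub -> W p vb -> W p wb -> W p zb ->
        [/\ momentum1 p T n kappa ub P wb =
              ((Xvec p wb)^T *m (K *m Xvec p ub - P *: Q1)) 0 0,
            momentum2 p T n kappa vb P zb =
              ((Xvec p zb)^T *m (K *m Xvec p vb - P *: Q2)) 0 0,
            mass p T n ub vb chi =
              (Q1^T *m Xvec p ub + Q2^T *m Xvec p vb) 0 0 * chi,
            load1 p T f wb = ((Xvec p wb)^T *m F1) 0 0 &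
            load2 p T f zb = ((Xvec p zb)^T *m F2) 0 0]].
Proof.
move=> polygon_T _ _ f1 f2 K Q1 Q2 F1 F2.
have [simple_p _ _ _] := polygon_T.
split.
- exact: MEM_unitmx.
(* One direction of [is_linear_extensionP] gives existence, the other uniqueness. *)
- move=> u _; exists (affine c (Dmx p c *m Xvec p u)); split.
    exact/(is_linear_extensionP p c).
  by move=> s /(is_linear_extensionP p c simple_p) ->.
- exact: element_stiffnessE.
- exact: element_loadE.
- move=> ub vb wb zb P chi _ _ _ _; split.
  + exact: momentum1E.
  + exact: momentum2E.
  + exact: weak_div_innerE.
  + exact: loadE.
  + exact: loadE.
Qed.
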